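(* Let $f\in\mathcal{F}_{\mu,L}(\mathbb{R}^d)$ and $h\in\mathcal{F}_{0,\infty}(\mathbb{R}^d)$, where $0<\mu\le L<\infty$, and consider the composite convex optimization problem $\min_{x\in\mathbb{R}^d}\{F(x)=f(x)+h(x)\}$ and a starting point $x_0\in\mathbb{R}^d$ satisfying $\partial F(x_0)\neq\emptyset$ (this last condition is only required for the result in residual gradient norm, i.e. the second identity below). The iterates $\{x_k\}_{k\ge 0}$ of the proximal gradient method with step size $0\le\gamma\le\frac{2}{L}$ satisfy the following: $$\max_{f\in\mathcal{F}_{\mu,L}(\mathbb{R}^d),\; h\in\mathcal{F}_{0,\infty}(\mathbb{R}^d),\; x_0\in\mathbb{R}^d}\left\{\frac{\|x_k-x_\star\|^2}{\|x_0-x_\star\|^2}\right\}=\rho^{2k}(\gamma),$$ $$\max_{f\in\mathcal{F}_{\mu,L}(\mathbb{R}^d),\; h\in\mathcal{F}_{0,\infty}(\mathbb{R}^d),\; x_0\in\mathbb{R}^d}\left\{\frac{\|\nabla f(x_k)+s_k\|^2}{\|\tilde\nabla F(x_0)\|^2}\right\}=\rho^{2k}(\gamma),$$ $$\max_{f\in\mathcal{F}_{\mu,L}(\mathbb{R}^d),\; h\in\mathcal{F}_{0,\infty}(\mathbb{R}^d),\; x_0\in\mathbb{R}^d}\left\{\frac{F(x_k)-F(x_\star)}{F(x_0)-F(x_\star)}\right\}=\rho^{2k}(\gamma),$$ where $x_\star\in\mathbb{R}^d$ denotes the (unique) optimal solution of the problem, $s_k$ denotes the subgradient of $h$ at $x_k$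 used in the proximal operation to generate $x_k$, and $\tilde\nabla F(x_0)\in\partial F(x_0)$ denotes an arbitrary subgradient of $F$ at $x_0$.
   Context: $\|\cdot\|$ is the Euclidean norm on $\mathbb{R}^d$ and $\partial$ denotes the convex subdifferential. $\mathcal{F}_{0,\infty}(\mathbb{R}^d)$ is the class of closed and proper convex functions $h:\mathbb{R}^d\to\mathbb{R}\cup\{\infty\}$. $\mathcal{F}_{\mu,L}(\mathbb{R}^d)$ is the class of closed and proper functions $f:\mathbb{R}^d\to\mathbb{R}$ that are differentiable over the whole of $\mathbb{R}^d$, $L$-smooth ($\|\nabla f(x+\Delta x)-\nabla f(x)\|\le L\|\Delta x\|$ for all $x,\Delta x\in\mathbb{R}^d$) and $\mu$-strongly convex ($f(x)-\frac{\mu}{2}\|x\|^2$ is a convex function on $\mathbb{R}^d$). The proximal operator is $\mathbf{p}_{\gamma h}(x)=\operatorname{argmin}_{y\in\mathbb{R}^d}\{\gamma h(y)+\frac12\|x-y\|^2\}$. The proximal gradient method with constant step size $\gamma$ started at $x_0$ generates $x_{k+1}=\mathbf{p}_{\gamma h}(x_k-\gamma\nabla f(x_k))$ for $k=0,1,2,\dots$. The subgradient used in the proximal operation generating $x_{k+1}$ is $s_{k+1}=\frac{x_k-x_{k+1}}{\gamma}-\nabla f(x_k)\in\partial h(x_{k+1})$, so that $\nabla f(x_{k+1})+s_{k+1}\in\partial F(x_{k+1})$. The rate is $\rho(\gamma)=\max\{|1-L\gamma|,|1-\mu\gamma|\}=\max\{L\gamma-1,\,1-\mu\gamma\}$, and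 $\rho^{2k}(\gamma)$ means $(\rho(\gamma))^{2k}$.
   Formalization: The second identity (residual gradient norm) is stated only for γ>0 and k≥1, since s_k=(x_{k-1}-x_k)/γ-∇f(x_{k-1}) is undefined for γ=0 or k=0; d≥1 is assumed and ratios are taken only where the denominator is nonzero. *)

(* Defs.v *)
From HB Require Import structures.
From mathcomp Require Import all_boot all_order all_algebra.
From mathcomp Require Import all_classical all_reals all_analysis.

Set Implicit Arguments.
Unset Strict Implicit.
Unset Printing Implicit Defensive.

Import Order.TTheory GRing.Theory Num.Theory.
Import numFieldNormedType.Exports.

Local Open Scope classical_set_scope.
Local Open Scope ring_scope.

Definition is_max {disp} {T : porderType disp} (A : set T) (m : T) : Prop :=
  A m /\ ubound A m.

Section ProximalGradient.
Context {R : realType} {d : nat}.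
Implicit Types (f : 'rV[R]_d -> R) (F h : 'rV[R]_d -> \bar R).
Implicit Types (x y g p u v : 'rV[R]_d) (mu L gamma : R) (k : nat).

Definition dotv u v : R := \sum_i u 0 i * v 0 i.

(* Not the library norm `|u|, which is the sup norm on row vectors. The topology
   and the notion of differentiability are the same for both norms. *)
Definition enorm u : R := Num.sqrt (dotv u u).

Definition grad f x : 'rV[R]_d := \row_i 'd f x (delta_mx 0 i).

Definition proper_fun F : Prop :=
  (exists x, (F x < +oo)%E) /\ (forall x, (-oo < F x)%E).

Definition epigraph F : set ('rV[R]_d * R) := [set p | (F p.1 <= p.2%:E)%E].

Definition closed_fun F : Prop := closed (epigraph F).

(* Used for functions that never take the value -oo, so that no sum +oo - oo
   occurs; at t = 0 and t = 1 the library convention 0 * +oo = 0 is the one of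
   convex analysis. *)
Definition econvex_fun F : Prop :=
  forall x y (t : R), 0 <= t <= 1 ->
    (F (t *: x + (1 - t) *: y)%R <= t%:E * F x + (1 - t)%R%:E * F y)%E.

(* The class F_{0,oo}(R^d) *)
Definition closed_proper_convex h : Prop :=
  [/\ closed_fun h, proper_fun h & econvex_fun h].

(* The class F_{mu,L}(R^d) *)
Definition smooth_strongly_convex mu L f : Prop :=
  [/\ closed_fun (EFin \o f) /\ proper_fun (EFin \o f),
      forall x, differentiable f x,
      forall x dx, enorm (grad f (x + dx) - grad f x) <= L * enorm dx &
      @convex_function R 'rV[R]_d setT
        (fun x => f x - mu / 2 * enorm x ^+ 2)].

Definition subdifferential F x : set 'rV[R]_d :=
  [set g | forall y, (F x + (dotv g (y - x)%R)%:E <= F y)%E].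

Definition minimizers F : set 'rV[R]_d := [set p | forall y, (F p <= F y)%E].

(* A minimizer, with the irrelevant default 0 when there is none. *)
Definition argmin F : 'rV[R]_d := xget 0 (minimizers F).

(* Since 0 * +oo = 0, prox 0 h is the identity map. *)
Definition prox gamma h x : 'rV[R]_d :=
  argmin (fun y => gamma%:E * h y + (2^-1 * enorm (x - y)%R ^+ 2)%R%:E)%E.

Definition objective f h x : \bar R := ((f x)%:E + h x)%E.

Definition xstar f h : 'rV[R]_d := argmin (objective f h).

Definition pg_iter gamma f h x0 k : 'rV[R]_d :=
  iter k (fun x => prox gamma h (x - gamma *: grad f x)) x0.

(* s_k; meaningful for k >= 1 and gamma > 0 only. *)
Definition pg_subgrad gamma f h x0 k : 'rV[R]_d :=
  gamma^-1 *: (pg_iter gamma f h x0 k.-1 - pg_iter gamma f h x0 k)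
  - grad f (pg_iter gamma f h x0 k.-1).

End ProximalGradient.

Definition rho {R : realType} (mu L gamma : R) : R :=
  Num.max `|1 - L * gamma| `|1 - mu * gamma|.

(* gradF f h x0 is an arbitrary choice of a subgradient of F = f + h at x0. *)
Definition subgradient_selection {R : realType} {d : nat} (mu L : R)
    (gradF : ('rV[R]_d -> R) -> ('rV[R]_d -> \bar R) -> 'rV[R]_d -> 'rV[R]_d) :
    Prop :=
  forall f h x0, smooth_strongly_convex mu L f -> closed_proper_convex h ->
    subdifferential (objective f h) x0 !=set0 ->
    subdifferential (objective f h) x0 (gradF f h x0).

(* Main.v *)
Require Import Defs.
From HB Require Import structures.
From mathcomp Require Import all_boot all_order all_algebra.
From mathcomp Require Import all_classical all_reals all_analysis.
From mathcomp Require Import ring lra.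

Set Implicit Arguments.
Unset Strict Implicit.
Unset Printing Implicit Defensive.

Import Order.TTheory GRing.Theory Num.Theory.
Import numFieldNormedType.Exports.

Local Open Scope classical_set_scope.
Local Open Scope ring_scope.

(** Write M = L - mu and rho = max (|1 - L gamma|, |1 - mu gamma|). Everything
about f enters through the interpolation inequality
  f y >= f x + <f' x, y - x> + mu/2 |y - x|^2
         + 1/(2M) |f' y - f' x - mu (y - x)|^2,
which also gives the cocoercivity of f' - mu and hence the rho-contractivity of
the gradient step. The distance rate then follows from the monotonicity of the
subdifferential of h at x_{k+1} and x_*, and the residual rate from its
monotonicity at x_k and x_{k+1}, since
  |f' x_{k+1} + s_{k+1}| <= rho |f' x_k + s_{k+1}| <= rho |f' x_k + s_k|.
For the objective values, adding the interpolation inequalities between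
(x_k, x_{k+1}), (z, x_k), (z, x_{k+1}) with weights rho, rho (1 - rho), 1 - rho
and the subgradient inequalities of h at x_{k+1} towards x_k and z with weights
rho^2 and 1 - rho^2 leaves a sum of squares, whatever the point z is. The
quadratics c/2 |x|^2 with c = mu or c = L and h = 0 attain all three rates. *)

(** * The Euclidean inner product, with elementary limit and mean value arguments *)

Section InnerProduct.
Context {R : realType} {d : nat}.
Implicit Types (u v w : 'rV[R]_d) (c : R).

Lemma dotvC u v : dotv u v = dotv v u.
Proof. by apply: eq_bigr => i _; rewrite mulrC. Qed.

Lemma dotvDl u v w : dotv (u + v) w = dotv u w + dotv v w.
Proof. by rewrite -big_split; apply: eq_bigr => i _; rewrite mxE mulrDl. Qed.

Lemma dotvZl c u v : dotv (c *: u) v = c * dotv u v.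
Proof. by rewrite mulr_sumr; apply: eq_bigr => i _; rewrite mxE mulrA. Qed.

Lemma dotvNl u v : dotv (- u) v = - dotv u v.
Proof. by rewrite -scaleN1r dotvZl mulN1r. Qed.

Lemma dotvDr u v w : dotv w (u + v) = dotv w u + dotv w v.
Proof. by rewrite dotvC dotvDl !(dotvC w). Qed.

Lemma dotvZr c u v : dotv v (c *: u) = c * dotv v u.
Proof. by rewrite dotvC dotvZl dotvC. Qed.

Lemma dotvNr u v : dotv v (- u) = - dotv v u.
Proof. by rewrite dotvC dotvNl dotvC. Qed.

Lemma dotv0l u : dotv 0 u = 0.
Proof. by rewrite -(scale0r 0) dotvZl mul0r. Qed.

Definition dotvE := (dotvDl, dotvDr, dotvNl, dotvNr, dotvZl, dotvZr).

Lemma dotv_ge0 u : 0 <= dotv u u.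
Proof. by apply: sumr_ge0 => i _; rewrite -expr2 sqr_ge0. Qed.

Lemma sqr_enorm u : enorm u ^+ 2 = dotv u u.
Proof. by rewrite sqr_sqrtr ?dotv_ge0. Qed.

Lemma enorm_ge0 u : 0 <= enorm u.
Proof. exact: sqrtr_ge0. Qed.

(** Bridge from the sup norm, which carries the topology, to the Euclidean one: the sup norm is
    attained at a coordinate whose square is one term of the sum. It gives definiteness of [dotv]
    and, later, coercivity. *)
Lemma sqr_norm_le_dotv u : `|u| ^+ 2 <= dotv u u.
Proof.
have [->|u0] := eqVneq (`|u|) 0; first by rewrite expr0n dotv_ge0.
have [[i j] eqn] := mx_norm_neq0 u0.
rewrite /Num.norm/= eqn/= (ord1 i) /dotv (bigD1 j)//= real_normK ?num_real//.
by rewrite expr2 lerDl sumr_ge0// => k _; rewrite -expr2 sqr_ge0.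
Qed.

Lemma dotv_eq0 u : (dotv u u == 0) = (u == 0).
Proof.
apply/eqP/eqP => [u0|->]; last exact: dotv0l.
have := sqr_norm_le_dotv u; rewrite u0 => le0.
by apply/eqP; rewrite -normr_eq0 -sqrf_eq0 eq_le le0 sqr_ge0.
Qed.

Lemma dotv_gt0 u : (0 < dotv u u) = (u != 0).
Proof. by rewrite lt_neqAle dotv_ge0 andbT eq_sym dotv_eq0. Qed.

Lemma dotv_ge_norm u v : - ((\sum_i `|u 0 i|) * `|v|) <= dotv u v.
Proof.
rewrite mulr_suml -sumrN; apply: ler_sum => i _.
rewrite -[leRHS]opprK lerN2 -mulNr (le_trans (ler_norm _))//.
rewrite normrM normrN ler_wpM2l// [leRHS]/Num.norm/= mx_normrE.
by apply/bigmax_geP; right; exists (0, i).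
Qed.

Lemma dotv_delta u i : dotv u (delta_mx 0 i) = u 0 i.
Proof.
rewrite /dotv (bigD1 i)//= mxE !eqxx mulr1 big1 ?addr0// => j ji.
by rewrite mxE (negbTE ji) andbF mulr0.
Qed.

End InnerProduct.

(** Stands in for letting t tend to 0 after a division by t. *)
Lemma le_of_le_small_linear {R : realFieldType} (a b C : R) :
  (forall t, 0 < t <= 1 -> a <= b + C * t) -> a <= b.
Proof.
move=> H; rewrite leNgt; apply/negP => ba.
have [C0|C0] := leP C 0.
  by have := H 1; rewrite ltr01 lexx => /(_ isT); lra.
(* Chosen so that [C * t] is at most half of the supposed gap [a - b]. *)
pose t := Num.min 1 ((a - b) / (2 * C)).
have t0 : 0 < t by rewrite lt_min ltr01 divr_gt0 ?subr_gt0 ?mulr_gt0.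
have := H t; rewrite t0 ge_min lexx => /(_ isT).
have : C * t <= (a - b) / 2.
  rewrite (le_trans (ler_wpM2l (ltW C0) (_ : t <= (a - b) / (2 * C))))//.
    by rewrite ge_min lexx orbT.
  by rewrite le_eqVlt; apply/orP; left; apply/eqP; field; rewrite gt_eqF.
lra.
Qed.

Lemma is_derive_parabola {R : realType} (psi : R -> R) (s a b p t : R) :
  is_derive t 1 psi p ->
  is_derive t 1 (fun r => s * (psi r - r * a) - r ^+ 2 * b)
    (s * (p - a) - 2 * t * b).
Proof.
move=> dpsi.
have -> : (fun r => s * (psi r - r * a) - r ^+ 2 * b) =
    s *: (psi - a *: id) - b *: (id ^+ 2).
  by apply/funext => r; rewrite /= !fctE /GRing.scale/=; ring.
by apply: is_derive_eq; rewrite /GRing.scale/=; ring.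
Qed.

(** The mean value theorem for [s * (psi r - r * a) - r ^+ 2 * b], whose derivative is nonpositive
    on positive [r]. Subtracting the parabola first keeps the sharp factor 1/2 without
    integration. *)
Lemma derive_le_parabola {R : realType} (psi dpsi : R -> R) (s a b : R) :
  (forall t : R, is_derive t 1 psi (dpsi t)) ->
  (forall t, 0 < t -> s * (dpsi t - a) <= 2 * t * b) ->
  s * (psi 1 - psi 0 - a) <= b.
Proof.
move=> isd le_b.
have isdq t := is_derive_parabola s a b (isd t).
set q := fun r => _ in isdq.
have qc : {within `[0, 1], continuous q}.
  apply: continuous_subspaceT => r; apply: differentiable_continuous.
  by apply/derivable1_diffP; apply: ex_derive.
have [c] := MVT ltr01 (fun r _ => isdq r) qc.
rewrite in_itv/= => /andP[c0 _]; move: (le_b c c0); rewrite /q.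
move=> {q qc isdq le_b}; rewrite /= subr0 mulr1 mul1r mul0r.
rewrite expr1n expr0n/= mul1r mul0r !subr0.
lra.
Qed.

(** * Smooth and strongly convex functions *)

Section Smooth.
Context {R : realType} {d : nat}.
Implicit Types (f : 'rV[R]_d -> R) (x y u v : 'rV[R]_d) (mu L : R).

Lemma dotv_grad f x v : differentiable f x -> dotv (grad f x) v = 'd f x v.
Proof.
move=> df; rewrite [in RHS](row_sum_delta v) linear_sum.
by apply: eq_bigr => i _; rewrite linearZ/= mxE mulrC.
Qed.

Lemma is_derive_line f x v t : differentiable f (x + t *: v) ->
  is_derive t 1 (fun s : R => f (x + s *: v)) (dotv (grad f (x + t *: v)) v).
Proof.
move=> df; rewrite dotv_grad//.
have dl : is_diff t (fun s : R => x + s *: v) (fun s => s *: v).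
  have : is_diff t (cst x + ( *:%R ^~ v)) (0 + ( *:%R ^~ v)) by exact: is_diffD.
  by rewrite add0r.
have [df2 E] : is_diff t (f \o (fun s : R => x + s *: v))
    ('d f (x + t *: v) \o (fun s => s *: v)).
  by apply: is_diff_comp; exact: differentiableP.
split; first exact/derivable1_diffP.
by rewrite deriveE// E/= scale1r.
Qed.

Lemma descent_le f L x v : 0 < L -> (forall y, differentiable f y) ->
  (forall y dy, enorm (grad f (y + dy) - grad f y) <= L * enorm dy) ->
  `|f (x + v) - f x - dotv (grad f x) v| <= L / 2 * dotv v v.
Proof.
move=> L0 df lip.
(* The sign [s] yields the upper and the lower bound from one computation. *)
have key (s : R) : s ^+ 2 = 1 ->
    s * (f (x + v) - f x - dotv (grad f x) v) <= L / 2 * dotv v v.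
  move=> s1.
  have isd (t : R) := is_derive_line (df (x + t *: v)).
  have := derive_le_parabola (s := s) (a := dotv (grad f x) v)
    (b := L / 2 * dotv v v) isd.
  rewrite scale1r scale0r addr0; apply => t t0.
  have := lip x (t *: v); rewrite -dotvNl -dotvDl.
  move: (grad f _ - _) => g le_g.
  have {}le_g : dotv g g <= (L * t) ^+ 2 * dotv v v.
    move: le_g; rewrite -(ler_pXn2r (ltn0Sn 1)) ?nnegrE ?mulr_ge0
      ?enorm_ge0 ?(ltW L0)//.
    rewrite exprMn !sqr_enorm dotvZl dotvZr.
    by move/le_trans; apply; rewrite le_eqVlt; apply/orP; left; apply/eqP; ring.
  (* Replaces Cauchy-Schwarz: this square and [le_g] bound [s * dotv g v] by [L * t * dotv v v]. *)
  have := dotv_ge0 (s *: g - (L * t) *: v).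
  have sgg : s * (s * dotv g g) = dotv g g by rewrite mulrA -expr2 s1 mul1r.
  rewrite !dotvE (dotvC v g) => sq_ge0.
  rewrite -(ler_pM2l (mulr_gt0 L0 t0)).
  lra.
rewrite ler_norml; apply/andP; split.
  by have := key (-1); rewrite sqrrN expr1n => /(_ erefl); rewrite mulN1r lerNl.
by have := key 1; rewrite expr1n mul1r => /(_ erefl).
Qed.

End Smooth.

(** For [M > 0] take [c] to be the inverse of [M]; for [M = 0] the factor [c] is unbounded, which
    forces [a = 0]. *)
Lemma le_of_le_scaled {R : realFieldType} (M a b : R) : 0 <= M -> 0 <= a ->
  (forall c, 0 <= c -> c * M <= 1 -> c * a <= b) -> a <= M * b.
Proof.
rewrite le_eqVlt => /predU1P[<- _ H|M0 _ H].
  rewrite mul0r leNgt; apply/negP => a0.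
  have := H ((`|b| + 1) / a).
  rewrite mulr0 ler01 divr_ge0 ?addr_ge0// ?(ltW a0)// => /(_ isT isT).
  by rewrite divfK ?gt_eqF//; have := ler_norm b; lra.
have := H M^-1; rewrite mulVf ?gt_eqF// lexx invr_ge0 ltW// => /(_ isT isT).
by rewrite ler_pdivrMl.
Qed.

(** * Interpolation inequality and cocoercivity *)

Section Interpolation.
Context {R : realType} {d : nat}.
Variables (mu L : R) (f : 'rV[R]_d -> R).
Hypotheses (mu_gt0 : 0 < mu) (mu_le_L : mu <= L).
Hypothesis f_ssc : smooth_strongly_convex mu L f.
Implicit Types x y v : 'rV[R]_d.

Let L_gt0 : 0 < L. Proof. exact: lt_le_trans mu_le_L. Qed.

Lemma strongly_convex_line x v (t : R) : 0 <= t <= 1 ->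
  f (x + t *: v) - mu / 2 * dotv (x + t *: v) (x + t *: v) <=
  (1 - t) * (f x - mu / 2 * dotv x x) +
  t * (f (x + v) - mu / 2 * dotv (x + v) (x + v)).
Proof.
move=> /andP[t0 t1]; case: f_ssc => _ _ _ cf.
have := cf (Itv01 t0 t1) (x + v) x; rewrite !in_setT => /(_ erefl erefl).
have <- : t *: (x + v) + (1 - t) *: x = x + t *: v.
  by apply/rowP => i; rewrite !mxE; ring.
by rewrite !sqr_enorm [leRHS]addrC.
Qed.

Lemma smooth_abs x v :
  `|f (x + v) - f x - dotv (grad f x) v| <= L / 2 * dotv v v.
Proof. by case: f_ssc => _ df lip _; exact: descent_le. Qed.

Lemma smooth_upper x v :
  f (x + v) <= f x + dotv (grad f x) v + L / 2 * dotv v v.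
Proof. by have := smooth_abs x v; rewrite ler_norml => /andP[_]; lra. Qed.

(** Compare the convexity bound on [f (x + t *: v)] with its first-order expansion, divide by t and
    let t tend to 0. The error is the smoothness term L/2 plus the curvature term mu/2, hence the
    constant [C]. *)
Lemma strongly_convex_lower x v :
  f x + dotv (grad f x) v + mu / 2 * dotv v v <= f (x + v).
Proof.
suff : dotv (grad f x) v + mu / 2 * dotv v v <= f (x + v) - f x by lra.
apply: (le_of_le_small_linear (C := (L + mu) / 2 * dotv v v)) => t.
move=> /andP[t0 t1].
rewrite -(ler_pM2l t0).
have := @strongly_convex_line x v t; rewrite t1 ltW// => /(_ isT).
have := smooth_abs x (t *: v); rewrite ler_norml => /andP[+ _].
by rewrite !dotvE (dotvC v x); lra.
Qed.

(* Evaluate f at y - c e with e = f' y - f' x - mu (y - x): above by smoothness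
   at y, below by strong convexity at x. The parameter c stands for 1 / (L - mu)
   and keeps the case L = mu uniform. *)
Lemma interpolation (c : R) x y : 0 <= c -> c * (L - mu) <= 1 ->
  f x + dotv (grad f x) (y - x) + mu / 2 * dotv (y - x) (y - x)
    + c / 2 * dotv (grad f y - grad f x - mu *: (y - x))
                   (grad f y - grad f x - mu *: (y - x))
  <= f y.
Proof.
move=> c0 cM.
have [v ->] : exists v, y = v + x by exists (y - x); rewrite subrK.
rewrite addrK.
have [e eE] : exists e, e = grad f (v + x) - grad f x - mu *: v.
  by exists (grad f (v + x) - grad f x - mu *: v).
have := strongly_convex_lower x (v - c *: e).
have := smooth_upper (v + x) (- (c *: e)).
have -> : grad f (v + x) = e + grad f x + mu *: v.
  by rewrite eE addrAC subrK subrK.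
have -> : e + grad f x + mu *: v - grad f x - mu *: v = e.
  by rewrite addrAC addrK addrK.
rewrite addrA (addrC x v).
move: (f (_ - _)) (f (v + x)) (f x) (grad f x) => F1 F2 F3 g.
have : 0 <= (c * (1 - c * (L - mu))) * dotv e e.
  by rewrite mulr_ge0 ?dotv_ge0// mulr_ge0 ?subr_ge0.
rewrite !dotvE (dotvC v e).
by lra.
Qed.

(** Adding the interpolation inequalities for (x, y) and (y, x) cancels the values of [f] and leaves
    [c] times the left side below the inner product, for every admissible [c]. *)
Lemma cocoercive x y :
  dotv (grad f y - grad f x - mu *: (y - x))
       (grad f y - grad f x - mu *: (y - x)) <=
  (L - mu) * dotv (grad f y - grad f x - mu *: (y - x)) (y - x).
Proof.
apply: le_of_le_scaled; rewrite ?subr_ge0 ?dotv_ge0// => c c0 cM.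
have := interpolation x y c0 cM.
have := interpolation y x c0 cM.
move: (f x) (f y) (grad f x) (grad f y) => fx fy gx gy.
rewrite !dotvE !(dotvC y x) !(dotvC gy) !(dotvC gx) !(dotvC _ gx) (dotvC gx gy).
lra.
Qed.

End Interpolation.

(** * Contraction factors and value certificates *)

(** Case analysis that replaces [rho] by its value without absolute values in each step-size regime;
    the regimes meet at gamma = 2 / (L + mu). *)
Variant rho_spec {R : realType} (mu L gamma : R) : R -> Prop :=
| RhoShort of gamma * (L + mu) <= 2 : rho_spec mu L gamma (1 - gamma * mu)
| RhoLong of 2 <= gamma * (L + mu) : rho_spec mu L gamma (gamma * L - 1).

Lemma rhoP {R : realType} (mu L gamma : R) : mu <= L -> 0 <= gamma ->
  rho_spec mu L gamma (rho mu L gamma).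
Proof.
move=> muL g0; rewrite /rho ![_ * gamma]mulrC.
have le_gL : gamma * mu <= gamma * L by rewrite ler_wpM2l.
have [short|long] := leP (gamma * (L + mu)) 2.
- have -> : Num.max `|1 - gamma * L| `|1 - gamma * mu| = 1 - gamma * mu.
    have le1 : gamma * mu <= 1 by lra.
    rewrite (ger0_norm (x := 1 - _ * mu)) ?subr_ge0//; apply: max_r.
    by rewrite ler_norml; lra.
  exact: RhoShort.
- have -> : Num.max `|1 - gamma * L| `|1 - gamma * mu| = gamma * L - 1.
    have le1 : 1 <= gamma * L by lra.
    rewrite distrC (ger0_norm (x := _ * L - 1)) ?subr_ge0//; apply: max_l.
    by rewrite ler_norml; lra.
  exact/RhoLong/ltW.
Qed.

Lemma rho_ge0 {R : realType} (mu L gamma : R) : 0 <= rho mu L gamma.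
Proof. by rewrite le_max normr_ge0. Qed.

Lemma rho_le1 {R : realType} (mu L gamma : R) :
  0 < mu -> mu <= L -> 0 <= gamma -> gamma <= 2 / L -> rho mu L gamma <= 1.
Proof.
move=> mu0 muL g0; rewrite ler_pdivlMr ?(lt_le_trans mu0)// => gL.
have le_gL : gamma * mu <= gamma * L by rewrite ler_wpM2l.
have gmu : 0 <= gamma * mu by rewrite mulr_ge0// ltW.
by rewrite ge_max !ler_norml !(mulrC _ gamma); lra.
Qed.

Section Certificates.
Context {R : realType} {d : nat}.
Variables (mu L gamma : R).
Hypotheses (mu_gt0 : 0 < mu) (mu_le_L : mu <= L) (gamma_ge0 : 0 <= gamma).
Implicit Types r g e : 'rV[R]_d.

(** Write g = e + mu r. Cocoercivity eliminates |e|^2 and leaves (1 - gamma mu)^2 |r|^2 + gamma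
    (gamma (L + mu) - 2) <e, r>. Since <e, r> lies between 0 and (L - mu) |r|^2, the sign of its
    coefficient selects the endpoint, hence the regime. *)
Lemma step_contraction r g :
  dotv (g - mu *: r) (g - mu *: r) <= (L - mu) * dotv (g - mu *: r) r ->
  dotv (r - gamma *: g) (r - gamma *: g) <= rho mu L gamma ^+ 2 * dotv r r.
Proof.
have [e ->] : exists e, g = e + mu *: r by exists (g - mu *: r); rewrite subrK.
rewrite addrK => coc.
have er_ge0 : 0 <= dotv e r.
  have : 0 <= L - mu by rewrite subr_ge0.
  rewrite le_eqVlt => /predU1P[M0|M0].
    move: coc; rewrite -M0 mul0r => e0.
    have /eqP : dotv e e == 0 by rewrite eq_le e0 dotv_ge0.
    by move/eqP; rewrite dotv_eq0 => /eqP ->; rewrite dotv0l.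
  by rewrite -(pmulr_rge0 _ M0) (le_trans (dotv_ge0 e)).
have coc2 : gamma ^+ 2 * dotv e e <= gamma ^+ 2 * ((L - mu) * dotv e r).
  by rewrite ler_wpM2l// sqr_ge0.
case: (rhoP mu_le_L gamma_ge0) => [short|long].
  have : 0 <= (gamma * (2 - gamma * (L + mu))) * dotv e r.
    by rewrite mulr_ge0// mulr_ge0// subr_ge0.
  by rewrite !dotvE (dotvC r e); lra.
have : 0 <= (gamma * (gamma * (L + mu) - 2)) * ((L - mu) * dotv r r - dotv e r).
  rewrite mulr_ge0// ?mulr_ge0// ?subr_ge0//.
  (* With [coc] this gives <e, r> <= (L - mu) |r|^2 after division by L - mu; if L = mu then [e]
     vanishes. *)
  have := dotv_ge0 (e - (L - mu) *: r).
  have : 0 <= L - mu by rewrite subr_ge0.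
  rewrite le_eqVlt => /predU1P[M0|M0].
    move: coc; rewrite -M0 !mul0r => e0 _.
    have /eqP : dotv e e == 0 by rewrite eq_le e0 dotv_ge0.
    by move/eqP; rewrite dotv_eq0 => /eqP ->; rewrite dotv0l.
  rewrite !dotvE (dotvC r e) => sq.
  rewrite -(ler_pM2l M0); lra.
by rewrite !dotvE (dotvC r e); lra.
Qed.

End Certificates.

(* The point z is translated to the origin. In the short-step case b is f' - mu,
   in the long-step case b is f' - L; [c] is 1 / (L - mu), or 0 when L = mu. The
   inequality between gamma and 2 rho c in the premises is the only place where
   the position of gamma relative to 2 / (L + mu) matters. *)
Section ValueCertificates.
Context {R : realType} {d : nat}.
Variables (x0 x1 b0 b1 bz s : 'rV[R]_d) (f0 f1 fz h0 h1 hz gamma rho c : R).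
Hypotheses (gamma_gt0 : 0 < gamma) (rho_ge0 : 0 <= rho) (rho_le1 : rho <= 1).
Hypothesis c_ge0 : 0 <= c.
Hypothesis h01 : h1 + dotv s (x0 - x1) <= h0.
Hypothesis hz1 : h1 - dotv s x1 <= hz.

Lemma value_certificate_short mu : mu = (1 - rho) / gamma ->
  gamma * dotv (b1 - b0) (b1 - b0) <= 2 * rho * c * dotv (b1 - b0) (b1 - b0) ->
  s = gamma^-1 *: (x0 - x1) - (b0 + mu *: x0) ->
  f1 + dotv (b1 + mu *: x1) (x0 - x1) + mu / 2 * dotv (x0 - x1) (x0 - x1)
    + c / 2 * dotv (b0 - b1) (b0 - b1) <= f0 ->
  f0 - dotv (b0 + mu *: x0) x0 + mu / 2 * dotv x0 x0
    + c / 2 * dotv (bz - b0) (bz - b0) <= fz ->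
  f1 - dotv (b1 + mu *: x1) x1 + mu / 2 * dotv x1 x1
    + c / 2 * dotv (bz - b1) (bz - b1) <= fz ->
  f1 + h1 - (fz + hz) <= rho ^+ 2 * (f0 + h0 - (fz + hz)).
Proof.
move=> ->; rewrite -subr_ge0 => gap sE i01 iz0 iz1.
move: h01 hz1; rewrite sE.
rewrite -!(subr_ge0 _ f0) -!(subr_ge0 _ fz) in i01 iz0 iz1.
rewrite -!(subr_ge0 _ h0) -!(subr_ge0 _ hz) => j0 jz.
have r1 : 0 <= 1 - rho by rewrite subr_ge0.
have r2 : 0 <= 1 - rho ^+ 2 by rewrite subr_ge0 expr_le1.
have K0 : 0 < 2 * gamma * (1 + rho) by rewrite !mulr_gt0// ltr_wpDr.
rewrite -subr_ge0 -(pmulr_rge0 _ K0).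
have p01 := mulr_ge0 rho_ge0 i01.
have pz0 := mulr_ge0 (mulr_ge0 rho_ge0 r1) iz0.
have pz1 := mulr_ge0 r1 iz1.
have q01 := mulr_ge0 (sqr_ge0 rho) j0.
have qz1 := mulr_ge0 r2 jz.
have := addr_ge0 (addr_ge0 (addr_ge0 (addr_ge0 p01 pz0) pz1) q01) qz1.
move/(mulr_ge0 (ltW K0))/addr_ge0.
(* The slack of the goal times [K0] is identically [K0] times the weighted sum plus three
   nonnegative terms: a square, a multiple of the slack [gap] and a square weighted by [c]. Writing
   [mu] through [rho] and [gamma] leaves [gamma] as the only denominator in this identity. *)
move=> /(_ _ (dotv_ge0 ((1 + rho) *: (rho *: x0 - x1) + gamma *: (b1 - b0)))).
move=> /addr_ge0/(_ (mulr_ge0 (ltW gamma_gt0) gap)).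
move=> /addr_ge0/(_ (mulr_ge0 (mulr_ge0 (mulr_ge0 c_ge0 (ltW gamma_gt0)) r1)
  (dotv_ge0 ((1 + rho) *: bz - rho *: b0 - b1)))).
congr (0 <= _).
rewrite !dotvE !(dotvC x1 x0) !(dotvC _ x0) !(dotvC _ x1).
rewrite (dotvC b1 b0) (dotvC bz b0) (dotvC bz b1).
by field; rewrite gt_eqF.
Qed.

Lemma value_certificate_long L : L = (1 + rho) / gamma ->
  gamma * dotv (b0 - bz) (b0 - bz) <= 2 * rho * c * dotv (b0 - bz) (b0 - bz) ->
  s = gamma^-1 *: (x0 - x1) - (b0 + L *: x0) ->
  f1 + dotv (b1 + L *: x1) (x0 - x1) + L / 2 * dotv (x0 - x1) (x0 - x1)
    + dotv (b0 - b1) (x0 - x1) + c / 2 * dotv (b0 - b1) (b0 - b1) <= f0 ->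
  f0 - dotv (b0 + L *: x0) x0 + L / 2 * dotv x0 x0
    - dotv (bz - b0) x0 + c / 2 * dotv (bz - b0) (bz - b0) <= fz ->
  f1 - dotv (b1 + L *: x1) x1 + L / 2 * dotv x1 x1
    - dotv (bz - b1) x1 + c / 2 * dotv (bz - b1) (bz - b1) <= fz ->
  f1 + h1 - (fz + hz) <= rho ^+ 2 * (f0 + h0 - (fz + hz)).
Proof.
move=> ->; rewrite -subr_ge0 => gap sE i01 iz0 iz1.
move: h01 hz1; rewrite sE.
rewrite -!(subr_ge0 _ f0) -!(subr_ge0 _ fz) in i01 iz0 iz1.
rewrite -!(subr_ge0 _ h0) -!(subr_ge0 _ hz) => j0 jz.
have r1 : 0 <= 1 - rho by rewrite subr_ge0.
have r2 : 0 <= 1 - rho ^+ 2 by rewrite subr_ge0 expr_le1.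
have K0 : 0 < 2 * gamma by rewrite mulr_gt0.
rewrite -subr_ge0 -(pmulr_rge0 _ K0).
have p01 := mulr_ge0 rho_ge0 i01.
have pz0 := mulr_ge0 (mulr_ge0 rho_ge0 r1) iz0.
have pz1 := mulr_ge0 r1 iz1.
have q01 := mulr_ge0 (sqr_ge0 rho) j0.
have qz1 := mulr_ge0 r2 jz.
have := addr_ge0 (addr_ge0 (addr_ge0 (addr_ge0 p01 pz0) pz1) q01) qz1.
move/(mulr_ge0 (ltW K0))/addr_ge0.
(* The five weights are those of the short-step case; only [K0] and the three added terms change. *)
move=> /(_ _ (mulr_ge0 r1 (dotv_ge0 (rho *: x0 + x1 + gamma *: (b0 - bz))))).
move=> /addr_ge0/(_ (mulr_ge0 (mulr_ge0 (ltW gamma_gt0) r1) gap)).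
move=> /addr_ge0/(_ (mulr_ge0 (mulr_ge0 c_ge0 (ltW gamma_gt0))
  (dotv_ge0 (b1 - rho *: b0 - (1 - rho) *: bz)))).
congr (0 <= _).
rewrite !dotvE !(dotvC x1 x0) !(dotvC _ x0) !(dotvC _ x1).
rewrite (dotvC b1 b0) (dotvC bz b0) (dotvC bz b1).
by field; rewrite gt_eqF.
Qed.

End ValueCertificates.

(** * Contraction of the objective gap in one step *)

Section ValueStep.
Context {R : realType} {d : nat}.
Variables (mu L gamma : R) (f : 'rV[R]_d -> R).
Hypotheses (mu_gt0 : 0 < mu) (mu_le_L : mu <= L).
Hypotheses (gamma_gt0 : 0 < gamma) (gamma_le : gamma <= 2 / L).
Hypothesis f_ssc : smooth_strongly_convex mu L f.
Implicit Types x y z s : 'rV[R]_d.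

(** Covers the degenerate case, in which cocoercivity has the factor 0 and kills the remainder. *)
Lemma grad_affine x y : L - mu = 0 -> grad f y - grad f x - mu *: (y - x) = 0.
Proof.
move=> M0; have := cocoercive mu_gt0 mu_le_L f_ssc x y.
rewrite M0 mul0r => le0.
by apply/eqP; rewrite -dotv_eq0 eq_le le0 dotv_ge0.
Qed.

(** By the convention that 0 has inverse 0, this is an admissible parameter of [interpolation] even
    when L = mu. *)
Let c := (L - mu)^-1.

Let c_ge0 : 0 <= c. Proof. by rewrite invr_ge0 subr_ge0. Qed.

Let c_le : c * (L - mu) <= 1.
Proof.
have [M0|M0] := eqVneq (L - mu) 0; first by rewrite M0 mulr0.
by rewrite mulVf.
Qed.

(** The interpolation inequality recentred at L, for the long-step regime. With remainder b relative
    to L, the remainder relative to mu is b + (L - mu) r; expanding its square moves the curvature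
    from mu to L and produces <b, r>. *)
Lemma interpolation_concave x y :
  f x + dotv (grad f x) (y - x) + L / 2 * dotv (y - x) (y - x)
    + dotv (grad f y - grad f x - L *: (y - x)) (y - x)
    + c / 2 * dotv (grad f y - grad f x - L *: (y - x))
                   (grad f y - grad f x - L *: (y - x))
  <= f y.
Proof.
have := interpolation mu_gt0 mu_le_L f_ssc x y c_ge0 c_le.
have := @grad_affine x y.
move: (y - x) (grad f y) (grad f x) => r gy gx affine.
have [M0|M0] := eqVneq (L - mu) 0.
  have muE : mu = L by lra.
  move: (affine M0); rewrite muE => ->.
  by rewrite !dotv0l addr0.
have [b ->] : exists b, gy = b + gx + L *: r.
  by exists (gy - gx - L *: r); rewrite addrAC subrK subrK.
have -> : b + gx + L *: r - gx - L *: r = b by rewrite addrAC addrK addrK.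
have -> : b + gx + L *: r - gx - mu *: r = b + (L - mu) *: r.
  by rewrite scalerBl addrA [b + gx + _]addrAC addrK.
apply: le_trans; rewrite -subr_ge0 le_eqVlt; apply/orP; left; apply/eqP.
by rewrite /c !dotvE (dotvC r b); field.
Qed.

(** Supplies the premise of the certificates that compares [gamma] with [2 * rho * c]. For L = mu,
    where [c] is 0, it holds because [u] vanishes. *)
Lemma le_gap (rho : R) (u : 'rV[R]_d) : gamma * (L - mu) <= 2 * rho ->
  (L - mu = 0 -> u = 0) -> gamma * dotv u u <= 2 * rho * c * dotv u u.
Proof.
move=> gM u0; have [M0|M0] := eqVneq (L - mu) 0.
  by rewrite u0// dotv0l !mulr0.
by rewrite ler_wpM2r ?dotv_ge0// ler_pdivlMr// lt_neqAle eq_sym M0 subr_ge0.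
Qed.

Lemma value_step x0 x1 z s (h0 h1 hz : R) :
  s = gamma^-1 *: (x0 - x1) - grad f x0 ->
  h1 + dotv s (x0 - x1) <= h0 -> h1 + dotv s (z - x1) <= hz ->
  f x1 + h1 - (f z + hz) <= rho mu L gamma ^+ 2 * (f x0 + h0 - (f z + hz)).
Proof.
have r1 := rho_le1 mu_gt0 mu_le_L (ltW gamma_gt0) gamma_le.
have r0 := rho_ge0 mu L gamma.
(* Translate [z] to the origin, as the certificates expect. *)
have [X0 ->] : exists X, x0 = X + z by exists (x0 - z); rewrite subrK.
have [X1 ->] : exists X, x1 = X + z by exists (x1 - z); rewrite subrK.
have X01 : X0 + z - (X1 + z) = X0 - X1 by rewrite opprD addrACA subrr addr0.
have X01' : X1 + z - (X0 + z) = X1 - X0 by rewrite opprD addrACA subrr addr0.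
have zX X : z - (X + z) = - X by rewrite opprD addrCA subrr addr0.
have e01 (k : R) (u v X Y : 'rV[R]_d) :
    u + k *: X - (v + k *: Y) - k *: (X - Y) = u - v.
  by apply/rowP => i; rewrite !mxE; ring.
have ez (k : R) (u v X : 'rV[R]_d) : u - (v + k *: X) - k *: (- X) = u - v.
  by apply/rowP => i; rewrite !mxE; ring.
case: (rhoP mu_le_L (ltW gamma_gt0)) r0 r1 => [short|long] r0 r1 sE.
- have gap : gamma * (L - mu) <= 2 * (1 - gamma * mu) by lra.
  have := @grad_affine (X0 + z) (X1 + z).
  have := interpolation mu_gt0 mu_le_L f_ssc (X1 + z) (X0 + z) c_ge0 c_le.
  have := interpolation mu_gt0 mu_le_L f_ssc (X0 + z) z c_ge0 c_le.
  have := interpolation mu_gt0 mu_le_L f_ssc (X1 + z) z c_ge0 c_le.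
  have muE : mu = (1 - (1 - gamma * mu)) / gamma by field; rewrite gt_eqF.
  rewrite X01' X01 !zX; move: sE; rewrite X01.
  move: (f (X0 + z)) (f (X1 + z)) (f z) => f0 f1 fz.
  move: (grad f (X0 + z)) (grad f (X1 + z)) (grad f z) => g0 g1 gz.
  have [b0 ->] : exists b, g0 = b + mu *: X0.
    by exists (g0 - mu *: X0); rewrite subrK.
  have [b1 ->] : exists b, g1 = b + mu *: X1.
    by exists (g1 - mu *: X1); rewrite subrK.
  rewrite !e01 !ez !dotvNr !dotvNl !opprK => sE' iz1 iz0 i01 affine h01 hz1.
  exact: (value_certificate_short gamma_gt0 r0 r1 c_ge0 h01 hz1 muE
    (le_gap gap affine) sE' i01 iz0 iz1).
- have gap : gamma * (L - mu) <= 2 * (gamma * L - 1) by lra.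
  have := @grad_affine z (X0 + z).
  have := interpolation_concave (X1 + z) (X0 + z).
  have := interpolation_concave (X0 + z) z.
  have := interpolation_concave (X1 + z) z.
  have LE : L = (1 + (gamma * L - 1)) / gamma by field; rewrite gt_eqF.
  rewrite X01 !zX addrK; move: sE; rewrite X01.
  move: (f (X0 + z)) (f (X1 + z)) (f z) => f0 f1 fz.
  move: (grad f (X0 + z)) (grad f (X1 + z)) (grad f z) => g0 g1 gz.
  have [b0 ->] : exists b, g0 = b + L *: X0.
    by exists (g0 - L *: X0); rewrite subrK.
  have [b1 ->] : exists b, g1 = b + L *: X1.
    by exists (g1 - L *: X1); rewrite subrK.
  rewrite !e01 !ez !dotvNr !dotvNl !opprK => sE' iz1 iz0 i01 affine h01 hz1.
  have {}affine : L - mu = 0 -> b0 - gz = 0.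
    move=> M0; rewrite -(affine M0); have -> : mu = L by lra.
    by rewrite [b0 + _ - _]addrAC addrK.
  exact: (value_certificate_long gamma_gt0 r0 r1 c_ge0 h01 hz1 LE
    (le_gap gap affine) sE' i01 iz0 iz1).
Qed.

End ValueStep.

(** * Existence of minimizers and subgradients *)

Section Minimizers.
Context {R : realType}.

(** Weierstrass for lower semicontinuous functions: the sublevel sets above the infimum generate a
    proper filter on [K], and a cluster point lies in each of them because they are closed. *)
Lemma compact_sublevel_min {T : topologicalType} (K : set T) (F : T -> \bar R) :
  compact K -> K !=set0 -> (forall r : R, closed [set x | (F x <= r%:E)%E]) ->
  exists2 p, K p & forall y, K y -> (F p <= F y)%E.
Proof.
move=> cK [x0 Kx0] cF; set m := ereal_inf (F @` K).
have Fm y : K y -> (m <= F y)%E by move=> Ky; apply: ereal_inf_lbound; exists y.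
have [Fx0|] := eqVneq (F x0) m; first by exists x0 => // y Ky; rewrite Fx0 Fm.
(* If the infimum is not attained at [x0], it is below +oo, so there are real levels above it. *)
move=> neq; have lt_m : (m < F x0)%E by rewrite lt_neqAle eq_sym neq Fm.
have m_fin : (m < +oo)%E by rewrite (lt_le_trans lt_m)// leey.
pose S (r : R) := K `&` [set x | (F x <= r%:E)%E].
pose G := filter_from [set r : R | (m < r%:E)%E] S.
have exr : exists r : R, (m < r%:E)%E.
  case: (m) m_fin => [r| |]//= _; last by exists 0; rewrite ltNyr.
  by exists (r + 1); rewrite lte_fin ltrDl.
have S_ne r : (m < r%:E)%E -> S r !=set0.
  move=> mr; have [_ [y Ky <-] Fy] := ereal_inf_lt mr.
  by exists y; split => //; exact: ltW.
have PG : ProperFilter G.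
  apply: filter_from_proper => //; apply: filter_from_filter => //.
  move=> r s mr ms; exists (Num.min r s).
    by rewrite /=; have [_|_] := leP r s.
  move=> y [Ky Fy]; split; split => //; apply: le_trans Fy _;
    by rewrite lee_fin ge_min lexx ?orbT.
have GK : G K by case: exr => r mr; exists r => // y [].
have [p [Kp clp]] := cK G PG GK.
exists p => // y Ky; apply: le_trans (Fm y Ky).
have Fp r : (m < r%:E)%E -> (F p <= r%:E)%E.
  move=> mr; apply: (cF r) => B nB.
  have [q [[_ Fq] Bq]] := clp (S r) B (ex_intro2 _ _ r mr (fun _ H => H)) nB.
  by exists q.
rewrite leNgt; apply/negP => mFp.
have [r mr rF] : exists2 r : R, (m < r%:E)%E & (r%:E < F p)%E.
  case: (m) (F p) mFp => [a| |] [b| |]//=.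
  - rewrite lte_fin => ab; exists ((a + b) / 2); rewrite lte_fin.
      by rewrite midf_lt.
    by rewrite midf_lt.
  - by move=> _; exists (a + 1); rewrite ?ltry// lte_fin ltrDl.
  - by move=> _; exists (b - 1); rewrite ?ltNyr// lte_fin gtrBl.
  - by move=> _; exists 0; rewrite ?ltNyr ?ltry.
by have := Fp r mr; rewrite leNgt rF.
Qed.

End Minimizers.

(** * Coercivity, existence of minimizers and a sum rule *)

Section ConvexFunctions.
Context {R : realType} {d : nat}.
Implicit Types (q : 'rV[R]_d -> R) (h : 'rV[R]_d -> \bar R).
Implicit Types x y v g : 'rV[R]_d.

Lemma compact_closed_ball x (r : R) :
  compact [set y : 'rV[R]_d | `|y - x| <= r].
Proof.
apply: bounded_closed_compact.
  exists (r + `|x|); split; first exact: num_real.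
  move=> M rM y /= yr; apply/ltW; apply: le_lt_trans rM.
  by rewrite -[y](subrK x) (le_trans (ler_normD _ _))// lerD2r.
apply: (@closed_comp _ _ (fun y => `|y - x|) [set s : R | s <= r]).
  move=> y _; apply: (@continuous_comp _ _ _ (fun y => y - x) (fun y => `|y|)).
    by apply: continuousB; [exact: cvg_id|exact: cst_continuous].
  exact: norm_continuous.
exact: closed_le.
Qed.

(** The set is the preimage of the epigraph of [h] under the continuous map y |-> (y, r - q y). *)
Lemma closed_sublevel q h (r : R) : closed_fun h -> continuous q ->
  closed [set y | (objective q h y <= r%:E)%E].
Proof.
move=> ch cq.
have -> : [set y | (objective q h y <= r%:E)%E] =
    (fun y => (y, r - q y)) @^-1` epigraph h.
  apply/funext => y; apply/propext; rewrite /objective /epigraph /=.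
  case: (h y) => [b| |].
  - by rewrite -EFinD !lee_fin addrC lerBrDr.
  - by rewrite addey// !leye_eq.
  - by rewrite addeNy// !leNye.
apply: closed_comp => // y _.
have cq' : r - q z @[z --> y] --> r - q y.
  exact: (@continuousB _ _ _ (cst r) q _ (@cst_continuous _ _ r y) (cq y)).
exact: cvg_pair cvg_id cq'.
Qed.

Lemma econvex_fin h x v (a b t : R) : econvex_fun h -> h x = a%:E ->
  h (x + v) = b%:E -> 0 <= t <= 1 ->
  (h (x + t *: v)%R <= (a + t * (b - a))%R%:E)%E.
Proof.
move=> cvx hx hv t01; have := cvx (x + v) x t t01; rewrite hx hv.
have -> : t *: (x + v) + (1 - t) *: x = x + t *: v.
  by apply/rowP => i; rewrite !mxE; ring.
rewrite -!EFinM -EFinD => /le_trans; apply.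
by rewrite lee_fin; lra.
Qed.

Lemma proper_finP h x : proper_fun h -> (h x < +oo)%E -> exists a, h x = a%:E.
Proof. by move=> [_ /(_ x)]; case: (h x) => [a| |]// _ _; exists a. Qed.

(* Compactness bounds h below on the unit ball; convexity along rays from x then
   propagates this to a bound linear in the norm. *)
Lemma convex_lower_norm h x (a : R) : closed_proper_convex h -> h x = a%:E ->
  exists A B : R, [/\ A <= a, 0 <= B &
    forall v, ((A - B * `|v|)%R%:E <= h (x + v)%R)%E].
Proof.
move=> [ch ph cvx] hx.
have clh (r : R) : closed [set y | (h y <= r%:E)%E].
  have := closed_sublevel (r := r) ch (@cst_continuous _ _ (0 : R)).
  by under eq_set do rewrite /objective add0e.
have [|p] := compact_sublevel_min (@compact_closed_ball x 1) _ clh.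
  by exists x; rewrite /= subrr normr0.
move=> _ pmin.
have hpx : (h p <= a%:E)%E by rewrite -hx; apply: pmin; rewrite /= subrr normr0.
have [|m hp] := proper_finP ph (x := p); first exact: le_lt_trans hpx (ltry _).
have ma : m <= a by rewrite hp lee_fin in hpx.
exists m, (a - m); split; rewrite ?subr_ge0// => v.
have [v1|v1] := leP `|v| 1.
  apply: (@le_trans _ _ m%:E).
    by rewrite lee_fin lerBlDr lerDl mulr_ge0// subr_ge0.
  by rewrite -hp; apply: pmin; rewrite /= addrC addKr.
case E : (h (x + v)) => [b| |]; last 2 first.
- by rewrite leey.
- by case: ph => _ /(_ (x + v)); rewrite E.
have v0 : 0 < `|v| by exact: lt_trans v1.
have := econvex_fin (t := `|v|^-1) cvx hx E.
rewrite invr_ge0 normr_ge0 invf_le1// (ltW v1) => /(_ isT).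
have : (m%:E <= h (x + `|v|^-1 *: v)%R)%E.
  rewrite -hp; apply: pmin; rewrite /= addrC addKr normrZ normfV normr_id.
  by rewrite mulVf// gt_eqF.
move=> /le_trans /[apply]; rewrite !lee_fin -(ler_pM2l v0).
by rewrite mulrDr mulrA mulfV ?gt_eqF// mul1r; nra.
Qed.

(** The quadratic growth of [q] beats the at most linear decay of [h], so outside a ball around [x0]
    the objective is at least its value at [x0]; on the ball compactness applies. *)
Lemma minimizer_exists q h : closed_proper_convex h -> continuous q ->
  (forall x, exists g, exists2 c : R, 0 < c &
     forall v, q x + dotv g v + c * dotv v v <= q (x + v)) ->
  minimizers (objective q h) !=set0.
Proof.
move=> cpc cq qlow; have [ch ph cvx] := cpc.
have [[x0 /(proper_finP ph)[a hx0]] hNy] := ph.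
have [A [B [Aa B0 hlow]]] := convex_lower_norm cpc hx0.
have [g [c c0 {}qlow]] := qlow x0.
pose G := \sum_i `|g 0 i|.
have G0 : 0 <= G by apply: sumr_ge0.
(* For |v| >= r both |v| >= 1 and c |v| >= G + B + (a - A), so c |v|^2 absorbs the linear terms and
   the constant a - A. *)
pose r := 1 + (G + B + (a - A)) / c.
have rhs0 : 0 <= G + B + (a - A).
  by apply: addr_ge0; [exact: addr_ge0|rewrite subr_ge0].
have r1 : 1 <= r by rewrite lerDl divr_ge0// ltW.
have far v : r <= `|v| -> (objective q h x0 <= objective q h (x0 + v)%R)%E.
  move=> rv; rewrite /objective hx0.
  apply: (@le_trans _ _ ((q (x0 + v)%R)%:E + (A - B * `|v|)%R%:E)%E);
    last exact: leeD.
  rewrite -!EFinD lee_fin.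
  have := qlow v; have := dotv_ge_norm g v; rewrite -/G => gv qv.
  have vv : c * `|v| ^+ 2 <= c * dotv v v.
    by rewrite ler_pM2l// sqr_norm_le_dotv.
  have v1 : 1 <= `|v| by exact: le_trans rv.
  have cv : c + (G + B + (a - A)) <= c * `|v|.
    have -> : c + (G + B + (a - A)) = c * r.
      by rewrite /r; field; rewrite gt_eqF.
    by rewrite ler_pM2l.
  have : 0 <= (c * `|v| - (G + B + (a - A))) * `|v|.
    by rewrite mulr_ge0// subr_ge0; lra.
  have : 0 <= (`|v| - 1) * (a - A) by rewrite mulr_ge0 ?subr_ge0.
  by lra.
have [|p _ pmin] := compact_sublevel_min (@compact_closed_ball x0 r) _
    (fun s => closed_sublevel (r := s) ch cq).
  by exists x0; rewrite /= subrr normr0 (le_trans _ r1).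
exists p => y; have [yr|yr] := leP `|y - x0| r; first exact: pmin.
apply: (@le_trans _ _ (objective q h x0)).
  by apply: pmin; rewrite /= subrr normr0 (le_trans _ r1).
by rewrite -(subrKC x0 y); apply: far; exact: ltW.
Qed.

Lemma subdifferential_fin h x : proper_fun h -> subdifferential h x !=set0 ->
  exists a, h x = a%:E.
Proof.
move=> ph [g gP]; apply: proper_finP => //.
have [[y hy] _] := ph; have := gP y.
by case: (h x) => [b| |]//=; rewrite ?ltry// addye// leNgt hy.
Qed.

(** Test the subgradient inequality at x + t v, bound [h] there by convexity, divide by t and let t
    tend to 0. Only a quadratic upper model of [q] at [x] enters, so one lemma serves both [f] and
    the quadratic of the proximal operator. *)
Lemma subdifferential_sum q h x g gq (C : R) : proper_fun h -> econvex_fun h ->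
  (forall v, q (x + v) <= q x + dotv gq v + C * dotv v v) ->
  subdifferential (objective q h) x g -> subdifferential h x (g - gq).
Proof.
move=> ph cvx qup gP.
have [a hx] : exists a, h x = a%:E.
  apply: proper_finP => //.
  have [[y hy] hNy] := ph; have := gP y; rewrite /objective.
  case: (h x) (hNy x) => [b| |]// _.
  by rewrite addey// addye//; case: (h y) hy.
move=> y; have [v ->] : exists v, y = x + v by exists (y - x); rewrite subrKC.
rewrite [x + v]addrC addrK [v + x]addrC hx.
case E : (h (x + v)) => [b| |]; last 2 first.
- by rewrite leey.
- by case: ph => _ /(_ (x + v)); rewrite E.
rewrite -EFinD lee_fin -lerBrDl.
apply: (le_of_le_small_linear (C := C * dotv v v)) => t /andP[t0 t1].
rewrite -(ler_pM2l t0).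
have := econvex_fin (t := t) cvx hx E; rewrite (ltW t0) t1 => /(_ isT).
have := gP (x + t *: v); rewrite /objective hx [x + _]addrC addrK.
rewrite [_ + x]addrC.
case: (h (x + t *: v)) => [b'| |]; last 2 first.
- by rewrite leye_eq.
- by rewrite addeNy -!EFinD.
rewrite -!EFinD !lee_fin; have := qup (t *: v).
by rewrite !dotvE; lra.
Qed.

End ConvexFunctions.

(** * Quadratics and the proximal operator *)

Section Quadratic.
Context {R : realType} {d : nat}.
Implicit Types (x y z v : 'rV[R]_d) (c : R).

Lemma differentiable_quadratic c z y :
  differentiable (fun x : 'rV[R]_d => c * dotv (x - z) (x - z)) y.
Proof.
have -> : (fun x : 'rV[R]_d => c * dotv (x - z) (x - z)) =
    c *: \sum_i ((fun x : 'rV[R]_d => x 0 i : R) - cst (z 0 i)) ^+ 2.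
  apply/funext => x; rewrite fctE fct_sumE; congr (c * _).
  by apply: eq_bigr => i _; rewrite !mxE expr2 !fctE.
apply: differentiableZ; apply: differentiable_sum => i.
apply: differentiableX; apply: differentiableB => //.
exact: differentiable_coord.
Qed.

Lemma grad_quadratic c z y :
  grad (fun x : 'rV[R]_d => c * dotv (x - z) (x - z)) y = (2 * c) *: (y - z).
Proof.
set q := fun x => _.
suff dq v : dotv (grad q y) v = (2 * c) * dotv (y - z) v.
  by apply/rowP => i; rewrite -[LHS]dotv_delta dq dotv_delta !mxE.
(* [q] along the line through [y] in direction [v], put into the form of [is_derive_parabola] with
   sign -1. *)
pose p (s : R) := (-1) * (cst (- q y) s - s * (2 * c * dotv (y - z) v))
  - s ^+ 2 * (- c * dotv v v).
have dline : is_derive (0 : R) (1 : R) (fun s : R => q (y + s *: v))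
    (dotv (grad q y) v).
  have := is_derive_line (f := q) (x := y) (v := v) (t := 0).
  by rewrite scale0r addr0; apply; exact: differentiable_quadratic.
have dpar : is_derive (0 : R) (1 : R) p (2 * c * dotv (y - z) v).
  have := is_derive_parabola (psi := cst (- q y)) (-1) (2 * c * dotv (y - z) v)
    (- c * dotv v v) (is_derive_cst (- q y) (0 : R) 1).
  by rewrite mulr0 mul0r subr0 sub0r mulN1r opprK.
have E : (fun s : R => q (y + s *: v)) = p.
  apply/funext => s; rewrite /p /q /=.
  by rewrite !dotvE !(dotvC z) !(dotvC v); ring.
rewrite -(@derive_val _ _ _ _ _ _ _ dline) E.
by rewrite (@derive_val _ _ _ _ _ _ _ dpar).
Qed.

Lemma smooth_strongly_convex_quadratic mu L c : 0 < mu -> mu <= c <= L ->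
  smooth_strongly_convex mu L
    (fun x : 'rV[R]_d => c / 2 * dotv (x - 0) (x - 0)).
Proof.
move=> mu0 /andP[muc cL]; split.
- split; last by split; [exists 0; rewrite /= ltry|move=> x; rewrite /= ltNyr].
  have cq : continuous (fun x : 'rV[R]_d => c / 2 * dotv (x - 0) (x - 0)).
    move=> x; apply: differentiable_continuous.
    exact: differentiable_quadratic.
  rewrite /closed_fun; set q := fun x => _ in cq *.
  have -> : epigraph (EFin \o q) =
      (fun p : 'rV[R]_d * R => q p.1 - p.2) @^-1` [set r : R | r <= 0].
    by apply/funext => p; rewrite /epigraph /= lee_fin subr_le0.
  apply: closed_comp; last exact: closed_le.
  move=> p _; apply: (@continuousB _ _ _ (q \o fst) snd); last exact: cvg_snd.
  by apply: continuous_comp; [exact: cvg_fst|exact: cq].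
- by move=> x; exact: differentiable_quadratic.
- move=> x v; rewrite !grad_quadratic.
  rewrite -(ler_pXn2r (ltn0Sn 1)) ?nnegrE ?mulr_ge0 ?enorm_ge0//; last first.
    by rewrite (le_trans (ltW mu0))// (le_trans muc).
  rewrite exprMn !sqr_enorm.
  have -> : (2 * (c / 2)) *: (x + v - 0) - (2 * (c / 2)) *: (x - 0) = c *: v.
    by apply/rowP => i; rewrite !mxE; field.
  rewrite dotvZl dotvZr mulrA -expr2 ler_wpM2r ?dotv_ge0//.
  by rewrite lerXn2r// nnegrE; lra.
- move=> t x y _ _; rewrite convRE !sqr_enorm !subr0.
  have -> : conv t x y =
    t%:num *: (x : 'rV[R]_d) + (1 - t%:num) *: (y : 'rV[R]_d) by [].
  have t0 : 0 <= t%:num :> R by [].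
  have t1 : t%:num <= 1 :> R by [].
  rewrite /unstable.onem; move: (t%:num) t0 t1 => s s0 s1.
  (* This is exactly the slack in the convexity inequality of the quadratic of curvature c - mu. *)
  have : 0 <= ((c - mu) / 2 * (s * (1 - s))) * dotv (x - y) (x - y).
    by rewrite mulr_ge0 ?dotv_ge0// !mulr_ge0 ?subr_ge0.
  by rewrite !dotvE (dotvC y x); lra.
Qed.

End Quadratic.

(** * The proximal operator and its subgradient *)

Section ProximalStep.
Context {R : realType} {d : nat}.
Implicit Types (h : 'rV[R]_d -> \bar R) (x y : 'rV[R]_d).

Lemma prox0 h x : prox 0 h x = x.
Proof.
have E y : ((0 : R)%:E * h y + (2^-1 * enorm (x - y)%R ^+ 2)%R%:E)%E =
    (2^-1 * dotv (x - y)%R (x - y)%R)%R%:E by rewrite mul0e add0e sqr_enorm.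
have : minimizers (fun y =>
    (0 : R)%:E * h y + (2^-1 * enorm (x - y)%R ^+ 2)%R%:E)%E (prox 0 h x).
  apply: xgetPex; exists x => y; rewrite !E lee_fin subrr dotv0l mulr0.
  by rewrite mulr_ge0 ?dotv_ge0.
move=> /(_ x); rewrite !E lee_fin subrr dotv0l mulr0 pmulr_rle0// => le0.
have : dotv (x - prox 0 h x) (x - prox 0 h x) == 0.
  by rewrite eq_le le0 dotv_ge0.
by rewrite dotv_eq0 subr_eq0 => /eqP.
Qed.

Variables (gamma : R).
Hypothesis gamma_gt0 : 0 < gamma.

(** Dividing by [gamma] gives the proximal problem the form [objective q h]. A minimizer exists, so
    [argmin] does not fall back on its default. *)
Lemma prox_minimizer h x : closed_proper_convex h ->
  minimizers (objective (fun y => gamma^-1 / 2 * dotv (y - x) (y - x)) h)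
    (prox gamma h x).
Proof.
move=> cpc; have [ch ph cvx] := cpc.
pose q y := gamma^-1 / 2 * dotv (y - x) (y - x).
have E y : (gamma%:E * h y + (2^-1 * enorm (x - y)%R ^+ 2)%R%:E)%E =
    (gamma%:E * objective q h y)%E.
  rewrite /objective muleDr// -EFinM addeC; congr (_%:E + _)%E.
  rewrite sqr_enorm -opprB dotvNl dotvNr opprK /q; field.
  by rewrite gt_eqF.
have [p pP] : minimizers (objective q h) !=set0.
  apply: minimizer_exists => // [y|y].
    by apply: differentiable_continuous; exact: differentiable_quadratic.
  exists (gamma^-1 *: (y - x)), (gamma^-1 / 2).
    by rewrite divr_gt0// invr_gt0.
  by move=> v; rewrite /q !dotvE !(dotvC x) !(dotvC v); lra.
have : minimizers (fun y =>
    gamma%:E * h y + (2^-1 * enorm (x - y)%R ^+ 2)%R%:E)%E (prox gamma h x).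
  apply: xgetPex; exists p => y; rewrite !E.
  by apply: lee_wpmul2l; [rewrite lee_fin ltW|exact: pP].
move=> H y; have := H y; rewrite !E.
by rewrite lee_pmul2l.
Qed.

(** Fermat's rule: 0 is a subgradient of the proximal objective at the minimizer, and the sum rule
    removes the gradient of the quadratic. *)
Lemma prox_subgradient h x : closed_proper_convex h ->
  subdifferential h (prox gamma h x) (gamma^-1 *: (x - prox gamma h x)).
Proof.
move=> cpc; have [ch ph cvx] := cpc.
have pmin := @prox_minimizer h x cpc.
move: (prox gamma h x) pmin => p pmin.
have -> : gamma^-1 *: (x - p) = 0 - gamma^-1 *: (p - x).
  by rewrite sub0r -scalerN opprB.
apply: (subdifferential_sum (C := gamma^-1 / 2) ph cvx); last first.
  by move=> y; rewrite dotv0l adde0; exact: pmin.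
by move=> v /=; rewrite !dotvE !(dotvC x) !(dotvC v); lra.
Qed.

End ProximalStep.

Lemma subdifferential_monotone {R : realType} {d : nat}
    (h : 'rV[R]_d -> \bar R) (x y g g' : 'rV[R]_d) : proper_fun h ->
  subdifferential h x g -> subdifferential h y g' -> 0 <= dotv (g - g') (x - y).
Proof.
move=> ph gx gy.
have [a hx] := subdifferential_fin ph (ex_intro _ g gx).
have [b hy] := subdifferential_fin ph (ex_intro _ g' gy).
have := gx y; have := gy x; rewrite hx hy -!EFinD !lee_fin.
have -> : y - x = - (x - y) by rewrite opprB.
by move: (x - y) => v; rewrite !dotvE; lra.
Qed.

(** * Upper bounds on the rates *)

Section Rates.
Context {R : realType} {d : nat}.
Variables (mu L gamma : R) (f : 'rV[R]_d -> R) (h : 'rV[R]_d -> \bar R).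
Hypotheses (mu_gt0 : 0 < mu) (mu_le_L : mu <= L).
Hypotheses (gamma_gt0 : 0 < gamma) (gamma_le : gamma <= 2 / L).
Hypotheses (f_ssc : smooth_strongly_convex mu L f).
Hypothesis h_cpc : closed_proper_convex h.
Implicit Types x y g : 'rV[R]_d.

Let h_proper : proper_fun h. Proof. by case: h_cpc. Qed.

Lemma objective_subgradient x g : subdifferential (objective f h) x g ->
  subdifferential h x (g - grad f x).
Proof.
case: h_cpc => _ ph cvx.
exact: (subdifferential_sum ph cvx (smooth_upper mu_gt0 mu_le_L f_ssc x)).
Qed.

Lemma xstarP : minimizers (objective f h) (xstar f h).
Proof.
apply: xgetPex; apply: minimizer_exists => // [y|y].
  by case: f_ssc => _ df _ _; exact/differentiable_continuous/df.
exists (grad f y), (mu / 2); first by rewrite divr_gt0.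
exact: (strongly_convex_lower mu_gt0 mu_le_L f_ssc).
Qed.

Lemma xstar_subgradient : subdifferential h (xstar f h) (- grad f (xstar f h)).
Proof.
rewrite -sub0r; apply: objective_subgradient => y.
by rewrite dotv0l adde0; exact: xstarP.
Qed.

Lemma pg_iterS x k : pg_iter gamma f h x k.+1 =
  prox gamma h
    (pg_iter gamma f h x k - gamma *: grad f (pg_iter gamma f h x k)).
Proof. by []. Qed.

Lemma pg_subgradP x k :
  subdifferential h (pg_iter gamma f h x k.+1) (pg_subgrad gamma f h x k.+1).
Proof.
have := prox_subgradient gamma_gt0
  (pg_iter gamma f h x k - gamma *: grad f (pg_iter gamma f h x k)) h_cpc.
rewrite -pg_iterS; congr (subdifferential h _ _).
rewrite /pg_subgrad -pred_Sn.
move: (pg_iter _ _ _ _ k.+1) (pg_iter _ _ _ _ k) (grad f) => y z G.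
by rewrite addrAC scalerBr scalerA mulVf ?gt_eqF// scale1r.
Qed.

Lemma gradient_step x y :
  dotv (x - y - gamma *: (grad f x - grad f y))
       (x - y - gamma *: (grad f x - grad f y))
    <= rho mu L gamma ^+ 2 * dotv (x - y) (x - y).
Proof.
apply: (step_contraction mu_le_L (ltW gamma_gt0)).
exact: (cocoercive mu_gt0 mu_le_L f_ssc).
Qed.

Lemma distance_step x k :
  dotv (pg_iter gamma f h x k.+1 - xstar f h)
       (pg_iter gamma f h x k.+1 - xstar f h)
  <= rho mu L gamma ^+ 2 *
     dotv (pg_iter gamma f h x k - xstar f h)
          (pg_iter gamma f h x k - xstar f h).
Proof.
have := subdifferential_monotone h_proper (pg_subgradP x k) xstar_subgradient.
have := gradient_step (pg_iter gamma f h x k) (xstar f h).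
rewrite /pg_subgrad -pred_Sn.
move: (pg_iter _ _ _ _ k.+1) (pg_iter _ _ _ _ k) (xstar f h) => y z u.
move: (grad f z) (grad f u) => gz gu.
have -> : gamma^-1 *: (z - y) - gz - - gu =
    gamma^-1 *: (z - u - gamma *: (gz - gu) - (y - u)).
  apply/rowP => i; rewrite !mxE.
  by field; rewrite gt_eqF.
(* Monotonicity now reads <w - r, r> >= 0, hence |r| <= |w|, where [w] is the difference of the two
   gradient steps. *)
move: (y - u) (z - u) (z - u - gamma *: _) => r v w step.
rewrite dotvZl pmulr_rge0 ?invr_gt0// => mono.
apply: le_trans step; have := dotv_ge0 (w - r); move: mono.
by rewrite !dotvE (dotvC r w); lra.
Qed.

(** The subgradient [g] is arbitrary because no s_0 exists: the induction starts from the chosen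
    subgradient of F at x_0 minus the gradient of [f], and continues with s_k. *)
Lemma residual_step x k (g : 'rV[R]_d) :
  subdifferential h (pg_iter gamma f h x k) g ->
  dotv (grad f (pg_iter gamma f h x k.+1) + pg_subgrad gamma f h x k.+1)
       (grad f (pg_iter gamma f h x k.+1) + pg_subgrad gamma f h x k.+1)
  <= rho mu L gamma ^+ 2 *
     dotv (grad f (pg_iter gamma f h x k) + g)
          (grad f (pg_iter gamma f h x k) + g).
Proof.
move=> /(subdifferential_monotone h_proper (pg_subgradP x k)).
have := gradient_step (pg_iter gamma f h x k) (pg_iter gamma f h x k.+1).
rewrite /pg_subgrad -pred_Sn.
move: (pg_iter _ _ _ _ k.+1) (pg_iter _ _ _ _ k) => y z.
move: (grad f z) (grad f y) => gz gy.
(* [v] is f' x_k + s_{k+1}, the middle term of the two comparisons. *)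
have [v vE] : exists v, v = gamma^-1 *: (z - y) by exists (gamma^-1 *: (z - y)).
have zyE : z - y = gamma *: v by rewrite vE scalerA mulfV ?gt_eqF// scale1r.
have -> : y - z = - (gamma *: v) by rewrite -zyE opprB.
rewrite -vE zyE -scalerBr.
have -> : v - (gz - gy) = gy + (v - gz) by rewrite opprB addrC -addrA (addrC v).
move: (gy + (v - gz)) => r; rewrite !dotvZl !dotvZr !dotvNr !dotvZr.
have -> : v - gz - g = v - (gz + g) by rewrite opprD addrA.
move: (gz + g) => b step mono.
have {}step : dotv r r <= rho mu L gamma ^+ 2 * dotv v v.
  rewrite -(ler_pM2l gamma_gt0) -(ler_pM2l gamma_gt0); apply: le_trans step _.
  by rewrite le_eqVlt; apply/orP; left; apply/eqP; ring.
apply: le_trans step _; rewrite ler_wpM2l ?sqr_ge0//.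
have {}mono : dotv (v - b) v <= 0.
  by move: mono; rewrite oppr_ge0 pmulr_rle0.
have := dotv_ge0 (v - b); move: mono.
by rewrite !dotvE (dotvC b v); lra.
Qed.

Lemma objective_fin x (a : R) : h x = a%:E -> objective f h x = (f x + a)%:E.
Proof. by rewrite /objective => ->. Qed.

Lemma xstar_fin : exists a : R, h (xstar f h) = a%:E.
Proof.
exact: (subdifferential_fin h_proper (ex_intro _ _ xstar_subgradient)).
Qed.

Lemma pg_iter_fin x k : exists a : R, h (pg_iter gamma f h x k.+1) = a%:E.
Proof.
exact: (subdifferential_fin h_proper (ex_intro _ _ (pg_subgradP x k))).
Qed.

(** Finiteness of [h] at the iterate belongs to the induction: later iterates carry a subgradient,
    while at the starting point it is assumed. *)
Lemma value_bound x k (a b : R) : h x = a%:E -> h (xstar f h) = b%:E ->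
  exists2 c : R, h (pg_iter gamma f h x k) = c%:E &
   f (pg_iter gamma f h x k) + c - (f (xstar f h) + b) <=
    rho mu L gamma ^+ (2 * k) * (f x + a - (f (xstar f h) + b)).
Proof.
move=> hx hs; elim: k => [|k [c hc IH]].
  by exists a; rewrite // muln0 expr0 mul1r.
have [c' hc'] := pg_iter_fin x k; exists c' => //.
have h0 := pg_subgradP x k (pg_iter gamma f h x k).
have hz := pg_subgradP x k (xstar f h).
rewrite hc' hc hs -!EFinD !lee_fin in h0 hz.
have := value_step mu_gt0 mu_le_L gamma_gt0 gamma_le f_ssc (erefl _) h0 hz.
move/le_trans; apply.
by rewrite mulnS exprD -mulrA ler_wpM2l// sqr_ge0.
Qed.

Lemma distance_bound x k :
  dotv (pg_iter gamma f h x k - xstar f h) (pg_iter gamma f h x k - xstar f h)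
  <= rho mu L gamma ^+ (2 * k) * dotv (x - xstar f h) (x - xstar f h).
Proof.
elim: k => [|k IH]; first by rewrite muln0 expr0 mul1r.
apply: le_trans (distance_step x k) _.
by rewrite mulnS exprD -mulrA ler_wpM2l// sqr_ge0.
Qed.

Lemma residual_bound x k (g : 'rV[R]_d) : subdifferential (objective f h) x g ->
  dotv (grad f (pg_iter gamma f h x k.+1) + pg_subgrad gamma f h x k.+1)
       (grad f (pg_iter gamma f h x k.+1) + pg_subgrad gamma f h x k.+1)
  <= rho mu L gamma ^+ (2 * k.+1) * dotv g g.
Proof.
move=> /objective_subgradient gP.
elim: k => [|k IH].
  have gE : grad f x + (g - grad f x) = g by rewrite addrC subrK.
  rewrite muln1 -[in leRHS]gE.
  exact: (@residual_step x 0 _ gP).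
apply: le_trans (residual_step (pg_subgradP x k)) _.
by rewrite [in leRHS]mulnS exprD -mulrA ler_wpM2l// sqr_ge0.
Qed.

End Rates.

(** * Worst-case instances *)

Lemma pg_iter_gamma0 {R : realType} {d : nat} (f : 'rV[R]_d -> R)
    (h : 'rV[R]_d -> \bar R) x k : pg_iter 0 f h x k = x.
Proof.
by elim: k => // k IH; rewrite pg_iterS IH prox0 scale0r subr0.
Qed.

Lemma rho_gamma0 {R : realType} (mu L : R) : rho mu L 0 = 1.
Proof. by rewrite /rho !mulr0 subr0 normr1 maxxx. Qed.

Section ZeroFunction.
Context {R : realType} {d : nat}.
Implicit Types x g : 'rV[R]_d.

Local Notation zero := (fun _ : 'rV[R]_d => 0%E : \bar R).

Lemma closed_proper_convex0 : closed_proper_convex zero.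
Proof.
split.
- rewrite /closed_fun; have -> : epigraph zero = snd @^-1` [set r : R | 0 <= r].
    by apply/funext => p; rewrite /epigraph /= lee_fin.
  by apply: closed_comp; [move=> p _; exact: cvg_snd|exact: closed_ge].
- by split; [exists 0; rewrite ltry|move=> x; rewrite ltNyr].
- by move=> x y t _; rewrite !mule0 adde0.
Qed.

Lemma subdifferential0 x g : subdifferential zero x g -> g = 0.
Proof.
move=> /(_ (g + x)); rewrite add0e addrK lee_fin => le0.
by apply/eqP; rewrite -dotv_eq0 eq_le le0 dotv_ge0.
Qed.

Lemma prox_zero (gamma : R) x : 0 <= gamma -> prox gamma zero x = x.
Proof.
rewrite le_eqVlt => /predU1P[<-|g0]; first exact: prox0.
have /subdifferential0/eqP := prox_subgradient g0 x closed_proper_convex0.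
by rewrite scaler_eq0 invr_eq0 gt_eqF//= subr_eq0 => /eqP.
Qed.

End ZeroFunction.

Section WorstCase.
Context {R : realType} {d : nat}.
Variables (mu L gamma c : R).
Hypotheses (mu_gt0 : 0 < mu) (mu_c : mu <= c) (c_L : c <= L).
Hypothesis gamma_ge0 : 0 <= gamma.
Implicit Types x g : 'rV[R]_d.

Let c_gt0 : 0 < c. Proof. exact: lt_le_trans mu_c. Qed.
Let mu_le_L : mu <= L. Proof. exact: le_trans c_L. Qed.

(* The redundant subtraction of 0 matches the quadratics of [prox]. *)
Definition quad x := c / 2 * dotv (x - 0) (x - 0).

Local Notation zero := (fun _ : 'rV[R]_d => 0%E : \bar R).

Lemma quad_ssc : smooth_strongly_convex mu L quad.
Proof. by apply: smooth_strongly_convex_quadratic => //; rewrite mu_c. Qed.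

Lemma grad_quad x : grad quad x = c *: x.
Proof. by rewrite /quad grad_quadratic subr0 mulrC divfK// pnatr_eq0. Qed.

Lemma xstar_quad : xstar quad zero = 0.
Proof.
have /subdifferential0/eqP :=
  xstar_subgradient mu_gt0 mu_le_L quad_ssc (closed_proper_convex0 (d := d)).
by rewrite grad_quad oppr_eq0 scaler_eq0 gt_eqF//= => /eqP.
Qed.

Lemma pg_iter_quad x k :
  pg_iter gamma quad zero x k = (1 - gamma * c) ^+ k *: x.
Proof.
elim: k => [|k IH]; first by rewrite scale1r.
rewrite pg_iterS prox_zero// IH grad_quad scalerA -{1}[_ *: x]scale1r -scalerBl.
by rewrite scalerA exprS.
Qed.

Lemma pg_subgrad_quad x k : 0 < gamma -> pg_subgrad gamma quad zero x k.+1 = 0.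
Proof.
move=> g0; apply: (@subdifferential0 _ _ (pg_iter gamma quad zero x k.+1)).
exact/pg_subgradP/closed_proper_convex0.
Qed.

Lemma objective_quad x : objective quad zero x = (c / 2 * dotv x x)%:E.
Proof. by rewrite /objective adde0 /quad subr0. Qed.

Lemma subdifferential_quad x : subdifferential (objective quad zero) x !=set0.
Proof.
exists (c *: x) => y; rewrite !objective_quad -EFinD lee_fin.
have : 0 <= c / 2 * dotv (y - x) (y - x).
  by rewrite mulr_ge0 ?dotv_ge0// divr_ge0// ltW.
by rewrite !dotvE (dotvC y x); lra.
Qed.

Lemma subdifferential_quadE x g : subdifferential (objective quad zero) x g ->
  g = c *: x.
Proof.
have h_cpc := closed_proper_convex0 (R := R) (d := d).
move/(objective_subgradient mu_gt0 mu_le_L quad_ssc h_cpc).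
by move/subdifferential0/eqP; rewrite subr_eq0 grad_quad => /eqP.
Qed.

End WorstCase.

(** The curvature of the worst quadratic is whichever of mu and L realizes the maximum. The squares
    absorb the sign of 1 - gamma c. *)
Lemma rho_attained {R : realType} (mu L gamma : R) : mu <= L ->
  exists c, [/\ mu <= c, c <= L & (1 - gamma * c) ^+ 2 = rho mu L gamma ^+ 2].
Proof.
move=> muL; rewrite /rho /Num.max; case: ifP => _.
  by exists mu; rewrite real_normK ?num_real// mulrC.
by exists L; rewrite real_normK ?num_real// mulrC.
Qed.

(** Each ratio is taken where its denominator is nonzero. The second needs gamma > 0 and k > 0 for
    s_k to make sense; the third is extended-real since F(x_0) may be +oo. *)
Theorem theorem2p1 (R : realType) (d : nat) (mu L gamma : R) (k : nat)
    (d_gt0 : (0 < d)%N) (mu_gt0 : 0 < mu) (mu_le_L : mu <= L)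
    (gamma_ge0 : 0 <= gamma) (gamma_le : gamma <= 2 / L) :
  [/\ is_max
        [set r : R | exists (f : 'rV[R]_d -> R) (h : 'rV[R]_d -> \bar R)
            (x0 : 'rV[R]_d),
          [/\ smooth_strongly_convex mu L f, closed_proper_convex h,
              x0 <> xstar f h &
              r = enorm (pg_iter gamma f h x0 k - xstar f h) ^+ 2
                  / enorm (x0 - xstar f h) ^+ 2]]
        (rho mu L gamma ^+ (2 * k)),
      forall gradF : ('rV[R]_d -> R) -> ('rV[R]_d -> \bar R) ->
          'rV[R]_d -> 'rV[R]_d,
        subgradient_selection mu L gradF -> 0 < gamma -> (0 < k)%N ->
        is_max
          [set r : R | exists (f : 'rV[R]_d -> R) (h : 'rV[R]_d -> \bar R)
              (x0 : 'rV[R]_d),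
            [/\ smooth_strongly_convex mu L f /\ closed_proper_convex h,
                subdifferential (objective f h) x0 !=set0,
                gradF f h x0 <> 0 &
                r = enorm (grad f (pg_iter gamma f h x0 k)
                           + pg_subgrad gamma f h x0 k) ^+ 2
                    / enorm (gradF f h x0) ^+ 2]]
          (rho mu L gamma ^+ (2 * k)) &
      is_max
        [set r : \bar R | exists (f : 'rV[R]_d -> R) (h : 'rV[R]_d -> \bar R)
            (x0 : 'rV[R]_d),
          [/\ smooth_strongly_convex mu L f, closed_proper_convex h,
              objective f h x0 <> objective f h (xstar f h) &
              r = ((objective f h (pg_iter gamma f h x0 k)
                    - objective f h (xstar f h))
                   / (objective f h x0 - objective f h (xstar f h)))%E]]
        (rho mu L gamma ^+ (2 * k))%:E].
Proof.
have [c [mu_c c_L cE]] := rho_attained gamma mu_le_L.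
have c_gt0 : 0 < c by exact: lt_le_trans mu_c.
have rho_pow : (1 - gamma * c) ^+ (2 * k) = rho mu L gamma ^+ (2 * k).
  by rewrite exprM cE -exprM.
have h_cpc := @closed_proper_convex0 R d.
have f_ssc := @quad_ssc R d mu L c mu_gt0 mu_c c_L.
(* A nonzero starting point for the worst-case quadratic; this is where d > 0 enters. *)
have [e e_neq0] : exists e : 'rV[R]_d, e != 0.
  exists (const_mx 1); apply/eqP => /rowP/(_ (Ordinal d_gt0)).
  by rewrite !mxE => /eqP; rewrite oner_eq0.
have ee_neq0 : dotv e e != 0 by rewrite dotv_eq0.
have xs0 : xstar (quad c) (fun=> 0%E) = 0 := xstar_quad mu_gt0 mu_c c_L.
have iterE x := pg_iter_quad c gamma_ge0 x k.
have rho_k_ge0 : 0 <= rho mu L gamma ^+ (2 * k) by rewrite exprn_ge0// rho_ge0.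
(* The one-step bounds assume gamma > 0; for gamma = 0 the iterates never move and the rate is 1. *)
have gamma_cases : gamma = 0 \/ 0 < gamma.
  by move: gamma_ge0; rewrite le_eqVlt => /predU1P[<-|]; [left|right].
split.
- split.
    exists (quad c), (fun=> 0%E), e; rewrite xs0; split => //; first exact/eqP.
    rewrite !subr0 iterE !sqr_enorm dotvZl dotvZr mulrA -expr2 -exprM.
    by rewrite (mulnC k) rho_pow mulfK.
  move=> _ [f [h [x0 [fP hP x0_neq ->]]]].
  rewrite !sqr_enorm ler_pdivrMr; last by rewrite dotv_gt0 subr_eq0; apply/eqP.
  case: gamma_cases => [g0|g0]; last exact: distance_bound.
  by rewrite g0 pg_iter_gamma0 rho_gamma0 expr1n mul1r.
- move=> gradF sel g0 k0; split.
    have ne := subdifferential_quad mu_gt0 mu_c e.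
    have gE := sel _ _ _ f_ssc h_cpc ne.
    move/(subdifferential_quadE mu_gt0 mu_c c_L) in gE.
    exists (quad c), (fun=> 0%E), e; split => //.
      by rewrite gE; apply/eqP; rewrite scaler_eq0 negb_or gt_eqF.
    have -> : pg_subgrad gamma (quad c) (fun=> 0%E) e k = 0.
      by case: (k) k0 => // j _; exact: pg_subgrad_quad.
    rewrite gE addr0 grad_quad iterE !sqr_enorm !dotvZl !dotvZr.
    rewrite -rho_pow (mulnC 2) exprM expr2.
    by field; rewrite ee_neq0 gt_eqF.
  move=> _ [f [h [x0 [[fP hP] ne g_neq ->]]]].
  rewrite !sqr_enorm ler_pdivrMr; last by rewrite dotv_gt0; apply/eqP.
  case: (k) k0 => // j _.
  exact/residual_bound/sel.
- split.
    exists (quad c), (fun=> 0%E), e; rewrite xs0 !objective_quad; split => //.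
      rewrite dotv0l mulr0 => -[] /eqP.
      by rewrite mulf_eq0 (negbTE ee_neq0) orbF gt_eqF// divr_gt0.
    rewrite dotv0l mulr0 sube0 sube0 inver mulf_eq0 (negbTE ee_neq0) orbF.
    rewrite gt_eqF ?divr_gt0//= iterE dotvZl dotvZr -EFinM.
    rewrite -rho_pow (mulnC 2) exprM expr2; congr (_%:E).
    by field; rewrite ee_neq0 gt_eqF.
  move=> _ [f [h [x0 [fP hP F_neq ->]]]].
  have [b hs] := xstar_fin mu_gt0 mu_le_L fP hP.
  have opt : (objective f h (xstar f h) <= objective f h x0)%E.
    exact: (xstarP mu_gt0 mu_le_L fP hP).
  case E : (h x0) => [a| |].
  - have [c' hc' bound] : exists2 c' : R, h (pg_iter gamma f h x0 k) = c'%:E &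
        f (pg_iter gamma f h x0 k) + c' - (f (xstar f h) + b) <=
        rho mu L gamma ^+ (2 * k) * (f x0 + a - (f (xstar f h) + b)).
      case: gamma_cases => [g0|g0]; last exact: value_bound.
      exists a; first by rewrite g0 pg_iter_gamma0.
      by rewrite g0 pg_iter_gamma0 rho_gamma0 expr1n mul1r.
    move: opt F_neq; rewrite (objective_fin _ E) (objective_fin _ hs).
    rewrite (objective_fin _ hc') lee_fin -!EFinD => opt F_neq.
    have gap : 0 < f x0 + a - (f (xstar f h) + b).
      rewrite subr_gt0 lt_neqAle opt andbT; apply/eqP => eqF.
      by apply: F_neq; rewrite eqF.
    by rewrite inver gt_eqF// -EFinM lee_fin ler_pdivrMr.
  (* Here F(x_0) = +oo, so the denominator is +oo, its inverse is 0 and the ratio is 0, also for k =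
     0 where the numerator is +oo. *)
  - rewrite /objective E hs addey// addye//.
    by rewrite invey mule0 lee_fin.
  - by case: hP => _ [_ /(_ x0)]; rewrite E.
Qed.
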